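(* Let $D\in\mathbb{N}$ ($D\ge 1$), let $G=(V,E)$ be a $D$-Ricci-flat finite graph, and let $\psi,\varphi\in C^1((0,\infty))$ be concave functions such that $C_\psi^\varphi>0$. Then $G$ satisfies the $CD_\psi^\varphi(d,0)$ inequality with $d=D/C_\psi^\varphi$.
   Context: A finite graph is a pair $G=(V,E)$ with $V$ a finite set and $E\subset V\times V$ a symmetric relation with $(v,v)\notin E$ for all $v$; write $v\sim w$ if $(v,w)\in E$. Let $\mathbb{R}^+=(0,\infty)$, $C(V)=\mathbb{R}^V$, and $C^+(V)=\{f:V\to\mathbb{R}^+\}$. Operations on functions on $V$ and inequalities between them are pointwise. Ricci-flatness: $G$ is $D$-Ricci-flat in $v\in V$ if all $w\in N(v):=\{v\}\cup\{w\in V:w\sim v\}$ have degree $D$ and there are maps $\eta_1,\ldots,\eta_D:N(v)\to V$ such that for all $w\in N(v)$ and all $i,j\in\{1,\ldots,D\}$ with $i\ne j$: $\eta_i(w)\sim w$, $\eta_i(w)\ne\eta_j(w)$, and $\bigcup_k\{\eta_k(\eta_i(v))\}=\bigcup_k\{\eta_i(\eta_k(v))\}$ (with the conditions involving only $i$ required for every $i\in\{1,\dots,D\}$). $G$ is $D$-Ricci-flat if it is $D$-Ricci-flat in all $v\in V$. Laplacian: $\Delta f(v)=\sum_{w\sim v}(f(w)-f(v))$ for $f\in C(V)$. For $\psi\in C^1(\mathbb{R}^+)$ and $f\in C^+(V)$, the $\psi$-Laplacian is $(\Delta^\psi f)(v)=\left(\Delta\left[\psi\left(\frac{f}{f(v)}\right)\right]\right)(v)$.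 For $\psi$ concave, put $\overline{\psi}(x)=\psi'(1)(x-1)-(\psi(x)-\psi(1))$ and $\Gamma^\psi=\Delta^{\overline\psi}$. Also $$(\Omega^\psi f)(v)=\left(\Delta\left[\psi'\left(\frac{f}{f(v)}\right)\cdot\frac{f}{f(v)}\left[\frac{\Delta f}{f}-\frac{(\Delta f)(v)}{f(v)}\right]\right]\right)(v),$$ $$2\Gamma_2^\psi(f)=\Omega^\psi f+\frac{\Delta f\,\Delta^\psi f}{f}-\frac{\Delta(f\Delta^\psi f)}{f}.$$ $CD^\varphi_\psi(d,K)$: $G$ satisfies it if for all $f\in C^+(V)$, $\Gamma_2^\psi(f)\ge\frac1d(\Delta^\varphi f)^2+K\Gamma^\psi(f)$. The constant $C_\psi^\varphi$: for $x,y>0$ let $$\widetilde{\psi}(x,y)=[\psi'(x)+\psi'(y)](1-xy)+x[\psi(y)-\psi(1/x)]+y[\psi(x)-\psi(1/y)],$$ $A_\varphi=\{(x,y)\in(\mathbb{R}^+)^2:\varphi(x)+\varphi(y)\ne2\varphi(1)\}$, and $$C_\psi^\varphi=\inf_{(x,y)\in A_\varphi}\frac{\widetilde\psi(x,y)}{(\varphi(x)+\varphi(y)-2\varphi(1))^2}\in[-\infty,\infty],$$ so that $C_\psi^\varphi=\infty$ if and only if $A_\varphi=\emptyset$ (equivalently, $\varphi$ is constant). In that degenerate case $\Delta^\varphi f=0$ for all $f$, and $\frac1d(\Delta^\varphi f)^2$ is read as $0$. *)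

(* Defs.v *)
From HB Require Import structures.
From mathcomp Require Import all_boot all_order all_algebra.
From mathcomp Require Import all_classical all_reals all_analysis.

Set Implicit Arguments.
Unset Strict Implicit.
Unset Printing Implicit Defensive.

Import Order.TTheory GRing.Theory Num.Theory.
Import numFieldNormedType.Exports.

Local Open Scope ring_scope.
Local Open Scope classical_set_scope.

Section Graph.
Variables (V : finType) (E : rel V).

Definition degree (v : V) : nat := #|[pred w | E v w]|.

(* The closed neighborhood N(v). *)
Definition clnbhd (v : V) : pred V := [pred w | (w == v) || E w v].

(* The maps eta_i : N(v) -> V are represented by total functions; their values
   outside N(v) are irrelevant, since eta_k(v) is a neighbor of v and hence
   lies in N(v). *)
Definition ricci_flat_at (D : nat) (v : V) : Prop :=
  (forall w, w \in clnbhd v -> degree w = D) /\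
  exists eta : 'I_D -> V -> V,
    [/\ forall w, w \in clnbhd v -> forall i, E (eta i w) w,
        forall w, w \in clnbhd v -> forall i j, i != j -> eta i w <> eta j w
      & forall i, range (fun k => eta k (eta i v)) =
                  range (fun k => eta i (eta k v))].

Definition ricci_flat (D : nat) : Prop := forall v, ricci_flat_at D v.

End Graph.

Section FunctionsOnHalfLine.
Variable R : realType.
Implicit Types psi phi : R -> R.

(* A function on (0, oo) is represented by a total function R -> R of which
   only the values on (0, oo) are ever used. *)
Definition C1_pos psi : Prop :=
  forall x, 0 < x -> derivable psi x 1 /\ {for x, continuous (derive1 psi)}.

Definition concave_pos psi : Prop :=
  convex_function (`]0, +oo[ : set R^o) (fun x => - psi x).

Definition psi_bar psi (x : R) : R :=
  derive1 psi 1 * (x - 1) - (psi x - psi 1).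

Definition psi_tilde psi (x y : R) : R :=
  (derive1 psi x + derive1 psi y) * (1 - x * y)
  + x * (psi y - psi x^-1) + y * (psi x - psi y^-1).

Definition A_set phi : set (R * R) :=
  [set p | [/\ 0 < p.1, 0 < p.2 & phi p.1 + phi p.2 <> 2 * phi 1]].

Definition C_const psi phi : \bar R :=
  ereal_inf
    [set (psi_tilde psi p.1 p.2 / (phi p.1 + phi p.2 - 2 * phi 1) ^+ 2)%:E
      | p in A_set phi].

End FunctionsOnHalfLine.

Section Curvature.
Variables (R : realType) (V : finType) (E : rel V).
Implicit Types (psi phi : R -> R) (f : V -> R).

Definition Lap f (v : V) : R := \sum_(w | E v w) (f w - f v).

Definition psiLap psi f (v : V) : R := Lap (fun w => psi (f w / f v)) v.

Definition Gamma psi f : V -> R := psiLap (psi_bar psi) f.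

Definition Omega psi f (v : V) : R :=
  Lap (fun w => derive1 psi (f w / f v) * (f w / f v)
                * (Lap f w / f w - Lap f v / f v)) v.

Definition Gamma2 psi f (v : V) : R :=
  (Omega psi f v + Lap f v * psiLap psi f v / f v
   - Lap (fun w => f w * psiLap psi f w) v / f v) / 2.

(* The dimension d is an extended real so that d = D / C makes sense for
   C = +oo: then d = 0, d^-1 = +oo, and, since 0 * +oo = 0, the term
   d^-1 * (psiLap phi f v)^2 is 0 as soon as psiLap phi f v = 0. *)
Definition CD phi psi (d : \bar R) (K : R) : Prop :=
  forall f, (forall v, 0 < f v) -> forall v,
    (d^-1 * ((psiLap phi f v) ^+ 2)%:E + (K * Gamma psi f v)%:E
      <= (Gamma2 psi f v)%:E)%E.

End Curvature.

(* Main.v *)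
Require Import Defs.
From mathcomp Require Import all_boot all_order all_algebra.
From mathcomp Require Import all_classical all_reals all_analysis.
From mathcomp Require Import ring lra.

(** Fix a vertex v and a positive f.  Write p i for the neighbors eta_i(v) and
    q i j = eta_j(eta_i(v)) for the vertices two steps away, and normalize the
    values of f to a_i = f(p i) / f(v) and b_ij = f(q i j) / f(v).  Expanding
    the Laplacians, the contributions of psi(1) cancel and
<<
  2 Gamma2(f)(v) = sum_ij psi'(a_i) (b_ij - a_i a_j)
                          + a_i (psi(a_j) - psi(b_ij / a_i)).
>>
    Ricci-flatness says that for every i the row (b_ij)_j and the column
    (b_ji)_j list the same values.  As a consequence, the sum over i, j of
    (psi'(a_i) - psi'(a_j)) (b_ij - a_i a_j) vanishes.  Subtracting it turns
    each summand into a nonnegative quantity, [tangent_gap]: a_i times the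
    distance from psi to its tangent at a_j, measured at b_ij / a_i.  So
    2 Gamma2 is a sum of tangent gaps ([sum_gap]).  The same rearrangement
    allows b_ji in place of b_ij, which gives a second such formula with the
    roles of a_i and a_j exchanged; adding both,
<<
  4 Gamma2(f)(v) = sum_ij gap(a_i, a_j, b_ij) + gap(a_j, a_i, b_ij).
>>
    For each i, exactly one second step returns to v: q i (s i) = v, so that
    b_(i, s i) = 1.  Only these terms are kept.  By [psi_tilde_gap] they are
    psi_tilde(a_i, a_(s i)), and s is a permutation because the columns of q
    are injective; it need not be an involution, which is why both formulas
    for Gamma2 are added.  This is [ricci_flat_bound].

    Finally psi_tilde(x, y) >= C (phi(x) + phi(y) - 2 phi(1))^2 for the
    constant C of the statement.  Summing over the pairs (a_i, a_(s i)) and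
    applying the Cauchy-Schwarz inequality to
    sum_i (phi(a_i) + phi(a_(s i)) - 2 phi(1)) = 2 (Delta^phi f)(v)
    yields Gamma2 >= (C / D) (Delta^phi f)^2.  If C = +oo, then phi is constant
    and only Gamma2 >= 0 remains to be shown, which is the same bound
    with psi_tilde >= 0. *)

Set Implicit Arguments.
Unset Strict Implicit.
Unset Printing Implicit Defensive.

Import Order.TTheory GRing.Theory Num.Theory.
Import numFieldNormedType.Exports.

Local Open Scope classical_set_scope.
Local Open Scope ring_scope.

(** * Tangents of concave functions *)

(** On the segment from x to y, concavity bounds the difference quotients
    (psi (x + t (y - x)) - psi x) / t, for 0 < t <= 1, below by psi y - psi x;
    as t tends to 0 they tend to the derivative in the direction y - x. *)
Lemma concave_tangent_le (R : realType) (psi : R -> R) (x y : R) :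
  concave_pos psi -> derivable psi x 1 -> 0 < x -> 0 < y ->
  psi y <= psi x + derive1 psi x * (y - x).
Proof.
move=> cpsi dpsi x0 y0.
have diffpsi : differentiable psi x by apply/derivable1_diffP.
have dE : 'D_(y - x) psi x = derive1 psi x * (y - x).
  rewrite derive1E !deriveE // -[X in 'd psi x X]mulr1.
  by rewrite -[(y - x) * 1]/((y - x) *: (1 : R^o)) linearZ /= mulrC.
rewrite -lerBlDl -dE.
have cvgd : (fun t : R => t^-1 *: (psi (t *: (y - x) + x) - psi x)) @ 0^'
    --> 'D_(y - x) psi x.
  exact: diff_derivable.
apply: (cvgr_to_ge (cvg_dnbhs_at_right cvgd)).
near=> t.
have t0 : 0 < t by [].
have t1 : t <= 1 by near: t; exact: nbhs_right_le.
have concave : - psi (t * y + (1 - t) * x) <= t * - psi y + (1 - t) * - psi x.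
  by apply: (cpsi (Itv01 (ltW t0) t1) y x); rewrite inE /= in_itv /= ?y0 ?x0.
rewrite -[_ *: _]/(_ * _) mulrC ler_pdivlMr //.
have -> : t *: (y - x) + x = t * y + (1 - t) * x.
  by rewrite -[_ *: _]/(_ * _); ring.
by lra.
Unshelve. all: by end_near.
Qed.

(** * Two inequalities for finite sums *)

Lemma ler_term_sum (R : numDomainType) (I : finType) (F : I -> R) (k : I) :
  (forall i, 0 <= F i) -> F k <= \sum_i F i.
Proof. by move=> F0; rewrite (bigD1 k) //= lerDl sumr_ge0. Qed.

(** The Cauchy-Schwarz inequality against the constant family 1, from the
    nonnegativity of the variance. *)
Lemma sqr_sum_le (R : realDomainType) n (t : 'I_n -> R) : (0 < n)%N ->
  (\sum_i t i) ^+ 2 <= n%:R * \sum_i t i ^+ 2.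
Proof.
move=> n0; set S := \sum_i t i; set Q := \sum_i _.
have : 0 <= \sum_i (n%:R * t i - S) ^+ 2.
  by rewrite sumr_ge0 // => i _; rewrite sqr_ge0.
have -> : \sum_i (n%:R * t i - S) ^+ 2 = n%:R * (n%:R * Q - S ^+ 2).
  have sqrE i : (n%:R * t i - S) ^+ 2 =
      n%:R ^+ 2 * t i ^+ 2 - 2 * n%:R * S * t i + S ^+ 2 by ring.
  rewrite (eq_bigr _ (fun i _ => sqrE i)).
  rewrite !big_split /= sumrN -!mulr_sumr sumr_const card_ord -/S -/Q.
  rewrite -mulr_natl.
  by ring.
by rewrite pmulr_rge0 ?ltr0n // subr_ge0.
Qed.

(** * Enumerations of vertices *)

Section Enumeration.
Variables (V : finType) (D : nat).
Implicit Types (p q : 'I_D -> V).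

Lemma sum_codom (M : nmodType) p (F : V -> M) :
  \sum_i F (p i) = \sum_(w <- codom p) F w.
Proof. by rewrite codomE big_map big_enum. Qed.

Lemma same_range_codom p q : range p = range q -> codom p =i codom q.
Proof.
move=> pq w; apply/codomP/codomP => -[i ->].
  by have [j _ <-] : range q (p i); [rewrite -pq; exists i | exists j].
by have [j _ <-] : range p (q i); [rewrite pq; exists i | exists j].
Qed.

(** A counting argument: q has D indices and the D distinct values of p. *)
Lemma injective_same_range p q :
  injective p -> range p = range q -> injective q.
Proof.
move=> /injectiveP pI /same_range_codom pq; apply/injectiveP.
by rewrite /injectiveb /dinjectiveb -(eq_uniq _ pq) ?size_codom.
Qed.

Lemma sum_same_range (M : nmodType) p q (F : V -> M) :
  injective p -> range p = range q -> \sum_i F (p i) = \sum_i F (q i).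
Proof.
move=> pI pq; rewrite !sum_codom; apply: perm_big; apply: uniq_perm.
- exact/injectiveP.
- exact/injectiveP/(injective_same_range pI pq).
- exact: same_range_codom.
Qed.

Lemma codom_nbr (E : rel V) v p :
  degree E v = D -> injective p -> (forall i, E v (p i)) -> codom p =i E v.
Proof.
move=> degv /injectiveP pI Ep.
have pE : {subset codom p <= enum (E v)}.
  by move=> w /codomP[i ->]; rewrite mem_enum; exact: Ep.
have [|_ pEi] := uniq_min_size pI pE.
  by rewrite size_codom card_ord -cardE -degv.
by move=> w; rewrite pEi mem_enum.
Qed.

Lemma sum_nbr (M : nmodType) (E : rel V) v p (F : V -> M) :
  degree E v = D -> injective p -> (forall i, E v (p i)) ->
  \sum_(w | E v w) F w = \sum_i F (p i).
Proof.
move=> degv pI Ep; rewrite sum_codom -[LHS]big_enum /=.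
apply: perm_big; apply: uniq_perm; first exact: enum_uniq.
  exact/injectiveP.
by move=> w; rewrite mem_enum (codom_nbr degv pI Ep).
Qed.

End Enumeration.

(** * Tangent gaps *)

Section Gap.
Variables (R : realType) (psi : R -> R).

(** The tangent of psi at y lies above psi; this is its height over psi at the
    point b / x, multiplied by x. *)
Definition tangent_gap (x y b : R) : R :=
  x * (psi y - psi (b / x)) + derive1 psi y * (b - x * y).

Lemma tangent_gap_ge0 x y b : concave_pos psi -> C1_pos psi ->
  0 < x -> 0 < y -> 0 < b -> 0 <= tangent_gap x y b.
Proof.
move=> cpsi dpsi x0 y0 b0.
have := concave_tangent_le cpsi (dpsi y y0).1 y0 (divr_gt0 b0 x0).
rewrite -(ler_pM2l x0) /tangent_gap.
have -> : x * (psi y + derive1 psi y * (b / x - y)) =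
    x * psi y + derive1 psi y * (b - x * y).
  by field; rewrite gt_eqF.
by lra.
Qed.

Lemma psi_tilde_gap x y :
  psi_tilde psi x y = tangent_gap x y 1 + tangent_gap y x 1.
Proof. by rewrite /psi_tilde /tangent_gap !div1r; ring. Qed.

Lemma psi_tilde_ge0 x y : concave_pos psi -> C1_pos psi ->
  0 < x -> 0 < y -> 0 <= psi_tilde psi x y.
Proof.
move=> cpsi dpsi x0 y0; rewrite psi_tilde_gap.
by apply: addr_ge0; exact: tangent_gap_ge0.
Qed.

(** The two sides differ by the sum of
    (psi'(a_i) - psi'(a_j)) (b_ij - a_i a_j).  Its part with a_i a_j is
    antisymmetric in i and j; its part with b_ij collects, at psi'(a_i), a row
    sum of b minus the corresponding column sum. *)
Lemma sum_gap D (a : 'I_D -> R) (b : 'I_D -> 'I_D -> R) :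
  (forall i, \sum_j b i j = \sum_j b j i) ->
  \sum_i \sum_j (derive1 psi (a i) * (b i j - a i * a j)
                 + a i * (psi (a j) - psi (b i j / a i)))
  = \sum_i \sum_j tangent_gap (a i) (a j) (b i j).
Proof.
move=> bT; apply/eqP; rewrite -subr_eq0 -sumrB; apply/eqP.
have termE i j : derive1 psi (a i) * (b i j - a i * a j)
    + a i * (psi (a j) - psi (b i j / a i)) - tangent_gap (a i) (a j) (b i j)
    = derive1 psi (a i) * (b i j - a i * a j)
    - derive1 psi (a j) * (b i j - a i * a j).
  by rewrite /tangent_gap; ring.
under eq_bigr do rewrite -sumrB (eq_bigr _ (fun j _ => termE _ j)) sumrB.
rewrite sumrB [X in _ - X]exchange_big /= -sumrB big1 // => i _.
rewrite -!mulr_sumr !sumrB bT.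
by rewrite (eq_bigr _ (fun j _ => mulrC (a j) (a i))) subrr.
Qed.

End Gap.

(** * The lower bound for Gamma2 at a Ricci-flat vertex *)

Section LocalBound.
Variables (R : realType) (V : finType) (E : rel V) (D : nat).
Variables (psi : R -> R) (f : V -> R) (v : V).
Hypothesis f0 : forall w, 0 < f w.

Lemma psiLap_enum phi (p : 'I_D -> V) :
  degree E v = D -> injective p -> (forall i, E v (p i)) ->
  psiLap E phi f v = \sum_i (phi (f (p i) / f v) - phi 1).
Proof.
move=> degv pI Ep; rewrite /psiLap /Lap (sum_nbr _ degv pI Ep).
by apply: eq_bigr => i _; rewrite divff // gt_eqF.
Qed.

(** The terms of Gamma2 with psi(1) cancel since v and all its neighbors have
    the same degree D; the summand of Omega at v itself is zero. *)
Lemma Gamma2_enum (p : 'I_D -> V) (q : 'I_D -> 'I_D -> V) :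
  degree E v = D -> injective p -> (forall i, E v (p i)) ->
  (forall i, degree E (p i) = D) -> (forall i, injective (q i)) ->
  (forall i j, E (p i) (q i j)) ->
  let a i := f (p i) / f v in let b i j := f (q i j) / f v in
  2 * Gamma2 E psi f v =
  \sum_i \sum_j (derive1 psi (a i) * (b i j - a i * a j)
                 + a i * (psi (a j) - psi (b i j / a i))).
Proof.
move=> degv pI Ep degp qI Eq a b.
have fn0 w : f w != 0 by rewrite gt_eqF.
have LapvE F : Lap E F v = \sum_i (F (p i) - F v).
  by rewrite /Lap (sum_nbr _ degv pI Ep).
have LappE F i : Lap E F (p i) = \sum_j (F (q i j) - F (p i)).
  by rewrite /Lap (sum_nbr _ (degp i) (qI i) (Eq i)).
rewrite /Gamma2 mulrC divfK // /Omega !LapvE !mulr_suml -big_split -sumrB /=.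
apply: eq_bigr => i _; rewrite /psiLap LappE !LapvE LappE !divff //.
rewrite /a /b.
have ratioE j : f (q i j) / f v / (f (p i) / f v) = f (q i j) / f (p i).
  by field; rewrite !fn0.
under [RHS]eq_bigr do rewrite ratioE.
rewrite [RHS]big_split /= -2!mulr_sumr !sumrB -mulr_sumr.
rewrite -(mulr_suml _ _ (fun j => f (q i j))).
rewrite -(mulr_suml _ _ (fun j => f (p j) - f v)).
rewrite -(mulr_suml _ _ (fun j => f (p j))).
rewrite !sumrB !sumr_const !card_ord.
by field; rewrite !fn0.
Qed.

(** In the conclusion, p enumerates the neighbors of v, and s i is the index of
    the step that leads from p i back to v. *)
Lemma ricci_flat_bound : symmetric E -> ricci_flat_at E D v ->
  concave_pos psi -> C1_pos psi ->
  exists (p : 'I_D -> V) (s : 'I_D -> 'I_D),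
  [/\ injective p, forall i, E v (p i), injective s &
    \sum_i psi_tilde psi (f (p i) / f v) (f (p (s i)) / f v)
      <= 4 * Gamma2 E psi f v].
Proof.
move=> Esym [deg [eta [Eeta eta_neq eta_comm]]] cpsi dpsi.
have Nv : v \in clnbhd E v by rewrite inE eqxx.
have etaE w : w \in clnbhd E v -> forall i, E w (eta i w).
  by move=> Nw i; rewrite Esym Eeta.
have etaI w : w \in clnbhd E v -> injective (eta ^~ w).
  by move=> Nw i j eij; apply: contrapT => /eqP /(eta_neq w Nw).
have Np i : eta i v \in clnbhd E v by rewrite inE /= Eeta // orbT.
pose p i := eta i v; pose q i j := eta j (p i).
have qI i : injective (q i) by exact: etaI (Np i).
have qC i : range (q i) = range (q ^~ i) by exact: eta_comm.
have qI' i : injective (q ^~ i) by exact: injective_same_range (qI i) (qC i).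
have /fin_all_exists[s sP] : forall i, exists j, q i j = v.
  move=> i; have : v \in E (p i) by rewrite unfold_in Eeta.
  rewrite -(codom_nbr (deg _ (Np i)) (qI i) (etaE _ (Np i))).
  by move=> /codomP[j vE]; exists j.
exists p, s; split; [exact: etaI Nv | exact: etaE Nv | |].
  by move=> i j sij; apply: (@qI' (s i)); rewrite /= sP sij sP.
pose a i := f (p i) / f v; pose b i j := f (q i j) / f v.
have a0 i : 0 < a i by rewrite divr_gt0.
have b0 i j : 0 < b i j by rewrite divr_gt0.
(* Rows and columns of b agree as multisets: this is the commutation of the
   maps eta. *)
have bC (F : R -> R) i : \sum_j F (b i j) = \sum_j F (b j i).
  exact: (sum_same_range (fun w => F (f w / f v)) (qI i) (qC i)).
have G2 := Gamma2_enum (deg v Nv) (etaI v Nv) (etaE v Nv)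
  (fun i => deg _ (Np i)) qI (fun i => etaE _ (Np i)).
have G2gap : 2 * Gamma2 E psi f v =
    \sum_i \sum_j tangent_gap psi (a i) (a j) (b i j).
  by rewrite G2 -sum_gap // => i; exact: (bC id).
have G2gapT : 2 * Gamma2 E psi f v =
    \sum_i \sum_j tangent_gap psi (a j) (a i) (b i j).
  rewrite exchange_big /= -(@sum_gap _ _ _ _ (fun i j => b j i)); last first.
    by move=> i; rewrite (bC id).
  rewrite G2; apply: eq_bigr => i _.
  (* Only F sees b, so the rest of the summand is unaffected by the
     rearrangement of row i. *)
  pose F y := derive1 psi (a i) * y - a i * psi (y / a i).
  have termE j y : derive1 psi (a i) * (y - a i * a j)
      + a i * (psi (a j) - psi (y / a i))
      = F y + (a i * psi (a j) - derive1 psi (a i) * (a i * a j)).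
    by rewrite /F; ring.
  rewrite (eq_bigr _ (fun j _ => termE j (b i j))).
  rewrite (eq_bigr _ (fun j _ => termE j (b j i))).
  by rewrite [LHS]big_split [RHS]big_split /= (bC F).
rewrite (_ : 4 * _ = 2 * Gamma2 E psi f v + 2 * Gamma2 E psi f v); last by ring.
rewrite {1}G2gap G2gapT -big_split /=; apply: ler_sum => i _.
rewrite psi_tilde_gap -big_split /=.
pose F j :=
  tangent_gap psi (a i) (a j) (b i j) + tangent_gap psi (a j) (a i) (b i j).
have F0 j : 0 <= F j by apply: addr_ge0; exact: tangent_gap_ge0.
apply: le_trans (ler_term_sum (s i) F0).
by rewrite /F /b sP divff // gt_eqF.
Qed.

End LocalBound.

(** * The constant C and the curvature-dimension inequality *)

(** Outside A_phi the left-hand side is zero and [psi_tilde_ge0] applies. *)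
Lemma psi_tilde_ge_C_const (R : realType) (psi phi : R -> R) (c x y : R) :
  concave_pos psi -> C1_pos psi -> (c%:E <= C_const psi phi)%E ->
  0 < x -> 0 < y ->
  c * (phi x + phi y - 2 * phi 1) ^+ 2 <= psi_tilde psi x y.
Proof.
move=> cpsi dpsi cC x0 y0.
have [phixy|phixy] := eqVneq (phi x + phi y) (2 * phi 1).
  by rewrite phixy subrr expr0n mulr0 psi_tilde_ge0.
rewrite -ler_pdivlMr; last by rewrite exprn_even_gt0 //= subr_eq0.
rewrite -lee_fin; apply: (le_trans cC); apply: ereal_inf_lbound.
by exists (x, y) => //; split=> //; exact/eqP.
Qed.

(** The infimum is +oo only over the empty set, since its terms are finite; and
    if (x, x) is not in A_phi, then phi x = phi 1. *)
Lemma psiLap_C_const_pinfty (R : realType) (V : finType) (E : rel V)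
    (psi phi : R -> R) (f : V -> R) v :
  C_const psi phi = +oo%E -> (forall w, 0 < f w) -> psiLap E phi f v = 0.
Proof.
move=> Cy f0; rewrite /psiLap /Lap big1 // => w _.
have phi_mid x : 0 < x -> phi x = phi 1.
  move=> x0; suff : phi x + phi x = 2 * phi 1 by lra.
  apply: contrapT => phix.
  have : (C_const psi phi <= (psi_tilde psi x x /
      (phi x + phi x - 2 * phi 1) ^+ 2)%:E)%E.
    by apply: ereal_inf_lbound; exists (x, x).
  by rewrite Cy.
by rewrite !phi_mid ?subrr // divr_gt0.
Qed.

Theorem theorem4p2 (R : realType) (V : finType) (E : rel V) (D : nat)
    (psi phi : R -> R) :
  symmetric E -> irreflexive E ->
  (0 < D)%N -> ricci_flat E D ->
  C1_pos psi -> concave_pos psi ->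
  C1_pos phi -> concave_pos phi ->
  (0 < C_const psi phi)%E ->
  CD E phi psi (D%:R%:E / C_const psi phi)%E 0%R.
Proof.
move=> Esym _ D0 flat dpsi cpsi _ _ C0 f f0 v.
rewrite mul0r adde0.
have [p [s [pI Ep sI G2]]] := ricci_flat_bound f0 Esym (flat v) cpsi dpsi.
have a0 i : 0 < f (p i) / f v by rewrite divr_gt0.
case CE : (C_const psi phi) C0 => [c| |] // C0.
- rewrite lte_fin in C0.
  have Dr : 0 < D%:R :> R by rewrite ltr0n.
  rewrite inver gt_eqF // -EFinM inver gt_eqF; last by rewrite divr_gt0.
  rewrite -EFinM lee_fin invf_div mulrAC ler_pdivrMr //.
  pose T i := phi (f (p i) / f v) + phi (f (p (s i)) / f v) - 2 * phi 1.
  have degv : degree E v = D by apply: (flat v).1; rewrite inE eqxx.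
  have sumT : \sum_i T i = 2 * psiLap E phi f v.
    rewrite (psiLap_enum f0 phi degv pI Ep) mulr_natl mulr2n.
    (* Each a_i also occurs once as a_(s j), s being a permutation. *)
    rewrite [X in _ = _ + X](reindex_inj sI) -big_split.
    by apply: eq_bigr => i _; rewrite /T /=; ring.
  have CT : c * \sum_i T i ^+ 2 <= 4 * Gamma2 E psi f v.
    apply: le_trans G2; rewrite mulr_sumr; apply: ler_sum => i _.
    by apply: psi_tilde_ge_C_const; rewrite // CE.
  have := sqr_sum_le T D0; rewrite sumT -(ler_pM2l C0) => cs.
  have := ler_wpM2l (ltW Dr) CT.
  by lra.
- (* Here d = 0, so 1 / d = +oo, which is multiplied by (Delta^phi f)^2 = 0. *)
  rewrite invey mule0 inve0 (psiLap_C_const_pinfty E v CE f0) expr0n mule0 lee_fin.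
  have : 0 <= 4 * Gamma2 E psi f v.
    by apply: le_trans G2; apply: sumr_ge0 => i _; exact: psi_tilde_ge0.
  by lra.
Qed.
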